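(* Let $(A,\cdot)$ be a left pre-Jacobi-Jordan algebra over a field $\mathbb{K}$ and let $(V,\rho,\mu)$ be a representation of $(A,\cdot)$. Then for every integer $n\ge 2$ one has $d^n\circ\delta^{n-1}=0$ on $\mathbf{A}^{n-1}(A,V)$, where $\delta^{n-1}:\mathbf{A}^{n-1}(A,V)\to \mathbf{C}^{n}(A,V)$ and $d^{n}:\mathbf{C}^{n}(A,V)\to\mathbf{C}^{n+1}(A,V)$ are the maps defined in the context.
   Context: All vector spaces and algebras are over a field $\mathbb{K}$. A left pre-Jacobi-Jordan algebra is a vector space $A$ with a bilinear product $\cdot$ such that $(x\cdot y)\cdot z+x\cdot(y\cdot z)+(y\cdot x)\cdot z+y\cdot(x\cdot z)=0$ for all $x,y,z\in A$. Put $x\ast y:=x\cdot y+y\cdot x$. A representation of $(A,\cdot)$ is a vector space $V$ with linear maps $\rho,\mu:A\to gl(V)$ (where $gl(V)$ denotes the linear endomorphisms of $V$) such that for all $x,y\in A$: $$\rho(x\ast y)+\rho(x)\circ\rho(y)+\rho(y)\circ\rho(x)=0,$$ $$\mu(x\cdot y)+\mu(y)\circ\mu(x)+\mu(y)\circ\rho(x)+\rho(x)\circ\mu(y)=0.$$ For $n\ge 1$, $\mathbf{C}^n(A,V)$ is the space of $n$-linear maps $A^{n}\to V$. The subspace $\mathbf{A}^n(A,V)\subseteq \mathbf{C}^n(A,V)$ consists of those $f\in \mathrm{Hom}(\wedge^{n-1}A\otimes A,V)$ (i.e. $n$-linear maps alternating in their first $n-1$ arguments) which, when $n\ge 2$,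 satisfy $$f(u\ast v,x_1,\dots,x_{n-2},w\cdot x_{n-1})+f(v\ast w,x_1,\dots,x_{n-2},u\cdot x_{n-1})+f(w\ast u,x_1,\dots,x_{n-2},v\cdot x_{n-1})=0$$ for all $u,v,w,x_1,\dots,x_{n-1}\in A$; for $n=1$ there is no condition, i.e. $\mathbf{A}^1(A,V)=\mathrm{Hom}(A,V)$. For $n\ge1$, $d^n:\mathbf{C}^n(A,V)\to\mathbf{C}^{n+1}(A,V)$ is $$d^nf(x_1,\dots,x_{n+1})=\sum_{i=1}^n\rho(x_i)f(x_1,\dots,\widehat{x_i},\dots,x_{n+1})+\sum_{i=1}^n\mu(x_{n+1})f(x_1,\dots,\widehat{x_i},\dots,x_n,x_i)$$ $$+\sum_{i=1}^nf(x_1,\dots,\widehat{x_i},\dots,x_n,x_i\cdot x_{n+1})+\sum_{1\le i<j\le n}f(x_i\ast x_j,x_1,\dots,\widehat{x_i},\dots,\widehat{x_j},\dots,x_{n+1}),$$ and $\delta^n:\mathbf{A}^n(A,V)\to\mathbf{C}^{n+1}(A,V)$ is $$\delta^nf(x_1,\dots,x_{n+1})=\sum_{i=1}^n\rho(x_i)f(x_1,\dots,\widehat{x_i},\dots,x_{n+1})+\sum_{i=1}^n\mu(x_{n+1})f(x_1,\dots,\widehat{x_i},\dots,x_n,x_i)$$ $$-\sum_{i=1}^nf(x_1,\dots,\widehat{x_i},\dots,x_n,x_i\cdot x_{n+1})-\sum_{1\le i<j\le n}f(x_i\ast x_j,x_1,\dots,\widehat{x_i},\dots,\widehat{x_j},\dots,x_{n+1}).$$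 Hats denote omitted arguments. *)

(* Defs.v *)
From HB Require Import structures.
From mathcomp Require Import all_boot all_order all_algebra.
Set Implicit Arguments.
Unset Strict Implicit.
Unset Printing Implicit Defensive.
Import GRing.Theory.
Local Open Scope ring_scope.

Section Arguments.
Variable A : Type.

Definition upd n (x : {ffun 'I_n -> A}) (i : 'I_n) (a : A) : {ffun 'I_n -> A} :=
  [ffun k => if k == i then a else x k].

(* (x_1, ..., x_n) |-> (x_1, ..., x_{n-1}, a) *)
Definition set_last n (x : {ffun 'I_n.+1 -> A}) (a : A) := upd x ord_max a.

(* (x_1, ..., x_n) |-> (a, x_1, ..., x_n) *)
Definition cons_arg n (a : A) (x : {ffun 'I_n -> A}) : {ffun 'I_n.+1 -> A} :=
  [ffun k => if unlift ord0 k is Some k' then x k' else a].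

(* The hat: [lift i] enumerates the positions other than [i] in order. *)
Definition omit n (i : 'I_n.+1) (x : {ffun 'I_n.+1 -> A}) : {ffun 'I_n -> A} :=
  [ffun k => x (lift i k)].

(* Omits the positions i < j among the first n+1 of the n+2 arguments.  The
   larger one is removed first, so that [i] still designates the same entry. *)
Definition omit2 n (i j : 'I_n.+1) (x : {ffun 'I_n.+2 -> A}) :
    {ffun 'I_n -> A} :=
  omit i (omit (lift ord_max j) x).

Lemma upd_eq n (x : {ffun 'I_n -> A}) i a : upd x i a i = a.
Proof. by rewrite ffunE eqxx. Qed.

Lemma upd_neq n (x : {ffun 'I_n -> A}) i k a : k != i -> upd x i a k = x k.
Proof. by rewrite ffunE => /negbTE->. Qed.

Lemma upd_upd n (x : {ffun 'I_n -> A}) i a b : upd (upd x i a) i b = upd x i b.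
Proof. by apply/ffunP=> k; rewrite !ffunE; case: eqP. Qed.

Lemma upd_updC n (x : {ffun 'I_n -> A}) i k a b : i != k ->
  upd (upd x i a) k b = upd (upd x k b) i a.
Proof.
move=> neq; apply/ffunP=> l; rewrite !ffunE.
by case: (eqVneq l k) => [->|//]; rewrite eq_sym (negbTE neq).
Qed.

Lemma omit_upd_eq n i (x : {ffun 'I_n.+1 -> A}) a : omit i (upd x i a) = omit i x.
Proof. by apply/ffunP=> k; rewrite !ffunE eq_sym (negbTE (neq_lift _ _)). Qed.

Lemma omit_upd_lift n i (x : {ffun 'I_n.+1 -> A}) k a :
  omit i (upd x (lift i k) a) = upd (omit i x) k a.
Proof. by apply/ffunP=> l; rewrite !ffunE (inj_eq (@lift_inj _ _)). Qed.

Lemma cons_arg_upd n b (x : {ffun 'I_n -> A}) k a :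
  cons_arg b (upd x k a) = upd (cons_arg b x) (lift ord0 k) a.
Proof.
apply/ffunP=> l; rewrite !ffunE; case: unliftP => [l' ->|->].
  by rewrite ffunE (inj_eq (@lift_inj _ _)).
by rewrite (negbTE (neq_lift _ _)).
Qed.

Lemma cons_arg_upd0 n (x : {ffun 'I_n -> A}) b c :
  cons_arg c x = upd (cons_arg b x) ord0 c.
Proof.
apply/ffunP=> l; rewrite !ffunE; case: unliftP => [l' ->|->]; last by rewrite eqxx.
by rewrite eq_sym (negbTE (neq_lift _ _)).
Qed.

Lemma last_lift_max n (i : 'I_n.+1) :
  (ord_max : 'I_n.+2) = lift (lift ord_max i) ord_max.
Proof. by apply/val_inj; rewrite [RHS]/= /bump [(n.+1 <= i)%N]leqNgt ltn_ord add0n leq_ord. Qed.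

End Arguments.

Section LeftPreJacobiJordan.
Variables (K : fieldType) (A : lmodType K) (mul : {bilinear A -> A -> A}).

Definition left_pre_jacobi_jordan : Prop :=
  forall x y z : A,
    mul (mul x y) z + mul x (mul y z) + mul (mul y x) z + mul y (mul x z) = 0.

Definition star (x y : A) : A := mul x y + mul y x.

(* A linear map from A to gl(V) is given as a bilinear map from A x V to V,
   so that [rho x v] is rho(x)(v). *)
Definition representation (V : lmodType K) (rho mu : {bilinear A -> V -> V}) :
    Prop :=
  (forall (x y : A) (v : V),
     rho (star x y) v + rho x (rho y v) + rho y (rho x v) = 0) /\
  (forall (x y : A) (v : V),
     mu (mul x y) v + mu y (mu x v) + mu y (rho x v) + rho x (mu y v) = 0).

End LeftPreJacobiJordan.

Definition multilinear (K : fieldType) (A V : lmodType K) n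
    (f : {ffun 'I_n -> A} -> V) : Prop :=
  forall (i : 'I_n) (x : {ffun 'I_n -> A}), linear (fun a => f (upd x i a)).

Record cochain (K : fieldType) (A V : lmodType K) (n : nat) := Cochain {
  cochain_fun :> {ffun 'I_n -> A} -> V;
  cochain_multilinear : multilinear cochain_fun
}.

Section AlternatingCochains.
Variables (K : fieldType) (A V : lmodType K) (mul : {bilinear A -> A -> A}).

Definition alternating_but_last n (f : cochain A V n.+1) : Prop :=
  forall (x : {ffun 'I_n.+1 -> A}) (i j : 'I_n), i != j ->
    x (lift ord_max i) = x (lift ord_max j) -> f x = 0.

Definition cyclic_condition n : cochain A V n.+1 -> Prop :=
  match n with
  | 0 => fun _ => True
  | m.+1 => fun f : cochain A V m.+2 =>
      forall (u v w : A) (x : {ffun 'I_m.+1 -> A}),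
        f (cons_arg (star mul u v) (set_last x (mul w (x ord_max)))) +
        f (cons_arg (star mul v w) (set_last x (mul u (x ord_max)))) +
        f (cons_arg (star mul w u) (set_last x (mul v (x ord_max)))) = 0
  end.

(* [acochain n] is the space A^{n+1}(A, V). *)
Record acochain (n : nat) := ACochain {
  acochain_cochain :> cochain A V n.+1;
  acochain_alternating : alternating_but_last acochain_cochain;
  acochain_cyclic : cyclic_condition acochain_cochain
}.

End AlternatingCochains.

Section Coboundary.
Variables (K : fieldType) (A V : lmodType K).
Variables (mul : {bilinear A -> A -> A}) (rho mu : {bilinear A -> V -> V}).

Section Terms.
Variables (n : nat) (f : cochain A V n.+1).

(* The four sums of the coboundary formulas for a cochain of degree n+1; the
   index i runs over all positions but the last, as [lift ord_max i]. *)
Definition sum_rho (x : {ffun 'I_n.+2 -> A}) : V :=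
  \sum_(i < n.+1) rho (x (lift ord_max i)) (f (omit (lift ord_max i) x)).

Definition sum_mu (x : {ffun 'I_n.+2 -> A}) : V :=
  \sum_(i < n.+1) mu (x ord_max)
    (f (set_last (omit (lift ord_max i) x) (x (lift ord_max i)))).

Definition sum_mul (x : {ffun 'I_n.+2 -> A}) : V :=
  \sum_(i < n.+1)
    f (set_last (omit (lift ord_max i) x) (mul (x (lift ord_max i)) (x ord_max))).

Definition sum_star (x : {ffun 'I_n.+2 -> A}) : V :=
  \sum_(i < n.+1) \sum_(j < n.+1 | (i < j)%N)
    f (cons_arg (star mul (x (lift ord_max i)) (x (lift ord_max j)))
                (omit2 i j x)).

Lemma multilinear_sum m (I : finType) (P : pred I)
    (F : I -> {ffun 'I_m -> A} -> V) :
  (forall i, P i -> multilinear (F i)) ->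
  multilinear (fun x => \sum_(i | P i) F i x).
Proof.
move=> FL k x c a b; rewrite scaler_sumr -big_split /=.
by apply: eq_bigr => i Pi; exact: FL.
Qed.

Lemma multilinear_add m (g h : {ffun 'I_m -> A} -> V) :
  multilinear g -> multilinear h -> multilinear (fun x => g x + h x).
Proof. by move=> gL hL k x c a b; rewrite gL hL scalerDr addrACA. Qed.

Lemma multilinear_opp m (g : {ffun 'I_m -> A} -> V) :
  multilinear g -> multilinear (fun x => - g x).
Proof. by move=> gL k x c a b; rewrite gL opprD scalerN. Qed.

Let fL := cochain_multilinear f.

Lemma cochain_cons_linear (y : {ffun 'I_n -> A}) :
  linear (fun a => f (cons_arg a y)).
Proof.
move=> c a b.
rewrite (cons_arg_upd0 y 0 (c *: a + b)) (cons_arg_upd0 y 0 a).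
by rewrite (cons_arg_upd0 y 0 b); exact: fL.
Qed.

Lemma star_linearl y : linear (fun x => star mul x y).
Proof.
by move=> c a b; rewrite /star linearPl linearPr scalerDr addrACA.
Qed.

Lemma starC x y : star mul x y = star mul y x.
Proof. by rewrite /star addrC. Qed.

Lemma sum_rho_multilinear : multilinear sum_rho.
Proof.
apply: multilinear_sum => i _ k x c a b /=.
case: (unliftP (lift ord_max i) k) => [k' ->|->].
  rewrite !omit_upd_lift !upd_neq ?neq_lift //.
  by rewrite fL linearPr.
by rewrite !omit_upd_eq !upd_eq linearPl.
Qed.

Lemma sum_mu_multilinear : multilinear sum_mu.
Proof.
apply: multilinear_sum => i _ k x c a b /=; rewrite /set_last.
case: (unliftP (lift ord_max i) k) => [k' ->|->]; last first.
  rewrite !omit_upd_eq !upd_eq !upd_neq ?neq_lift //.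
  by rewrite fL linearPr.
rewrite !omit_upd_lift !(@upd_neq _ _ _ _ (lift ord_max i)) ?neq_lift //.
case: (eqVneq k' ord_max) => [->|ne].
  by rewrite -last_lift_max !upd_eq !upd_upd linearPl.
rewrite !upd_neq; try by rewrite {1}(last_lift_max i) (inj_eq (@lift_inj _ _)) eq_sym.
by rewrite !(upd_updC _ _ _ ne) fL linearPr.
Qed.

Lemma sum_mul_multilinear : multilinear sum_mul.
Proof.
apply: multilinear_sum => i _ k x c a b /=; rewrite /set_last.
case: (unliftP (lift ord_max i) k) => [k' ->|->]; last first.
  rewrite !omit_upd_eq !upd_eq !upd_neq ?neq_lift //.
  by rewrite linearPl fL.
rewrite !omit_upd_lift !(@upd_neq _ _ _ _ (lift ord_max i)) ?neq_lift //.
case: (eqVneq k' ord_max) => [->|ne].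
  by rewrite -last_lift_max !upd_eq !upd_upd linearPr fL.
rewrite !upd_neq; try by rewrite {1}(last_lift_max i) (inj_eq (@lift_inj _ _)) eq_sym.
by rewrite !(upd_updC _ _ _ ne) fL.
Qed.

Lemma lift_max_lt (i j : 'I_n.+1) : (i < j)%N ->
  lift ord_max i = lift (lift ord_max j) i :> 'I_n.+2.
Proof.
move=> ij; apply/val_inj; rewrite /= /bump ![(n.+1 <= _)%N]leqNgt !ltn_ord /= !add0n.
by rewrite leqNgt ij.
Qed.

Lemma sum_star_multilinear : multilinear sum_star.
Proof.
apply: multilinear_sum => i _; apply: multilinear_sum => j ij k x c a b /=.
rewrite /omit2.
case: (unliftP (lift ord_max j) k) => [k' ->|->]; last first.
  rewrite !omit_upd_eq !upd_eq !upd_neq; try by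
    rewrite (inj_eq (@lift_inj _ _)) -val_eqE /= ltn_eqF.
  by rewrite !(starC (x _)) star_linearl cochain_cons_linear.
rewrite !omit_upd_lift !(@upd_neq _ _ _ _ (lift ord_max j)) ?neq_lift //.
rewrite (lift_max_lt ij).
case: (unliftP i k') => [k'' ->|->]; last first.
  by rewrite !omit_upd_eq !upd_eq star_linearl cochain_cons_linear.
rewrite !omit_upd_lift !upd_neq; try by
  rewrite (inj_eq (@lift_inj _ _)) neq_lift.
by rewrite !cons_arg_upd fL.
Qed.

End Terms.

Lemma d_multilinear n (f : cochain A V n.+1) :
  multilinear (fun x => sum_rho f x + sum_mu f x + sum_mul f x + sum_star f x).
Proof.
do 3?apply: multilinear_add.
- exact: sum_rho_multilinear.
- exact: sum_mu_multilinear.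
- exact: sum_mul_multilinear.
- exact: sum_star_multilinear.
Qed.

Lemma delta_multilinear n (f : cochain A V n.+1) :
  multilinear (fun x => sum_rho f x + sum_mu f x - sum_mul f x - sum_star f x).
Proof.
do 3?apply: multilinear_add.
- exact: sum_rho_multilinear.
- exact: sum_mu_multilinear.
- by apply: multilinear_opp; exact: sum_mul_multilinear.
- by apply: multilinear_opp; exact: sum_star_multilinear.
Qed.

(* [d n] and [delta n] are the maps written d^{n+1} and delta^{n+1}. *)
Definition d n (f : cochain A V n.+1) : cochain A V n.+2 :=
  Cochain (d_multilinear f).

Definition delta n (f : acochain V mul n) : cochain A V n.+2 :=
  Cochain (delta_multilinear f).

End Coboundary.

(* Main.v *)
Require Import Defs.
From mathcomp Require Import all_boot all_order all_algebra.
Import GRing.Theory.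
Local Open Scope ring_scope.

(* Evaluating cochains on a list s of leading arguments and a last argument
   turns the coboundary sums into sums over the ways of extracting one or two
   entries of s.  Composing two such sums produces sums over pairs and triples
   of extracted entries, and the terms of d (delta f) cancel as follows, a, b, c
   being the extracted entries and y the last argument of d (delta f):
   - rho rho terms: first axiom of a representation;
   - rho mu, mu rho, mu mu and mu(a . y) terms: second axiom;
   - terms f(..., a . (b . y)) and f(..., (a * b) . y): the algebra identity;
   - terms f(a * b, ..., c . y): cyclic condition, once from sum_mul o sum_star
     and once from sum_star o sum_mul;
   - terms f((a * b) * c, ..., y): Jacobi identity for *;
   - terms f(a * b, c * e, ..., y): alternation.
   The remaining terms cancel in pairs. *)

(** * Reindexing of iterated sums over extracted entries *)

Section Picks.
Context {T : Type}.
Implicit Types (s : seq T).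

(* The pairs (entry, remaining list); below, [picks2] and [picks3] extract two
   and three entries, listed in their order in [s]. *)
Fixpoint picks s : seq (T * seq T) :=
  if s is a :: t then
    (a, t) :: [seq (p.1, a :: p.2) | p <- picks t] else [::].

Fixpoint picks2 s : seq (T * T * seq T) :=
  if s is a :: t then
    [seq (a, p.1, p.2) | p <- picks t] ++
    [seq (p.1, a :: p.2) | p <- picks2 t] else [::].

Fixpoint picks3 s : seq (T * T * T * seq T) :=
  if s is a :: t then
    [seq (a, p.1.1, p.1.2, p.2) | p <- picks2 t] ++
    [seq (p.1, a :: p.2) | p <- picks3 t] else [::].

Definition del (i : nat) s := take i s ++ drop i.+1 s.

Lemma size_del i s : (i < size s)%N -> (size (del i s)).+1 = size s.
Proof.
move=> lis; rewrite size_cat size_take size_drop lis -addnS -subSn //.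
by rewrite subSS subnKC // ltnW.
Qed.

Lemma nth_del x0 i s k : (i < size s)%N -> nth x0 (del i s) k = nth x0 s (bump i k).
Proof.
move=> lis; rewrite nth_cat size_take lis /bump.
case: ltnP => lik; first by rewrite nth_take // leqNgt lik.
by rewrite nth_drop addSn subnKC // add1n.
Qed.

Lemma del_rcons i s w : (i < size s)%N -> del i (rcons s w) = rcons (del i s) w.
Proof.
by move=> lis; rewrite /del -[in take _ _]cats1 takel_cat 1?ltnW // drop_rcons // rcons_cat.
Qed.

Context {V : zmodType}.

(** Links the indexed sums of the coboundary formulas to [picks], on which one can induct; [H] stays
    general because the head passes into its list argument. *)
Lemma big_picks_nth x0 s (H : T -> seq T -> V) :
  \sum_(i < size s) H (nth x0 s i) (del i s) = \sum_(p <- picks s) H p.1 p.2.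
Proof.
elim: s H => [|a t IH] H /=; first by rewrite big_ord0 big_nil.
rewrite big_ord_recl big_cons big_map /= /del /= drop0; congr (_ + _).
exact: IH (fun b r => H b (a :: r)).
Qed.

Lemma big_picks2_nth x0 s (H : T -> T -> seq T -> V) :
  \sum_(i < size s) \sum_(j < size s | (i < j)%N)
    H (nth x0 s i) (nth x0 s j) (del i (del j s)) =
  \sum_(p <- picks2 s) H p.1.1 p.1.2 p.2.
Proof.
elim: s H => [|a t IH] H /=; first by rewrite big_ord0 big_nil.
rewrite big_ord_recl big_cat !big_map /=; congr (_ + _).
  rewrite big_mkcond big_ord_recl /= add0r -(big_picks_nth x0).
  by apply: eq_bigr => j _; rewrite /del /= drop0.
rewrite -(IH (fun b c r => H b c (a :: r))); apply: eq_bigr => i _.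
rewrite big_mkcond big_ord_recl /= add0r -big_mkcond /=.
exact: eq_bigr.
Qed.

(** Two successive extractions reach each pair of positions once in each order. *)
Lemma big_picks_picks s (H : T -> T -> seq T -> V) :
  \sum_(p <- picks s) \sum_(q <- picks p.2) H p.1 q.1 q.2 =
  \sum_(p <- picks2 s) (H p.1.1 p.1.2 p.2 + H p.1.2 p.1.1 p.2).
Proof.
elim: s H => [|a t IH] H /=; first by rewrite !big_nil.
rewrite big_cons big_map big_cat !big_map /=.
under [X in _ + X = _]eq_bigr => p _ do rewrite big_cons big_map.
by rewrite big_split addrA (IH (fun b c r => H b c (a :: r))) -big_split.
Qed.

Lemma big_picks_picksC s (H : T -> T -> seq T -> V) :
  \sum_(p <- picks s) \sum_(q <- picks p.2) H p.1 q.1 q.2 =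
  \sum_(p <- picks s) \sum_(q <- picks p.2) H q.1 p.1 q.2.
Proof.
rewrite big_picks_picks (big_picks_picks s (fun a b => H b a)).
by apply: eq_bigr => p _; rewrite addrC.
Qed.

(** Each triple of positions arises three times, according to which member is extracted alone. *)
Lemma big_picks_picks2 s (H : T -> T -> T -> seq T -> V) :
  \sum_(p <- picks s) \sum_(q <- picks2 p.2) H p.1 q.1.1 q.1.2 q.2 =
  \sum_(p <- picks3 s) (H p.1.1.1 p.1.1.2 p.1.2 p.2 +
    (H p.1.1.2 p.1.1.1 p.1.2 p.2 + H p.1.2 p.1.1.1 p.1.1.2 p.2)).
Proof.
elim: s H => [|a t IH] H /=; first by rewrite !big_nil.
rewrite big_cons big_map big_cat !big_map /=.
under [X in _ + X = _]eq_bigr => p _ do rewrite big_cat !big_map.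
rewrite big_split /= addrA (IH (fun b c d r => H b c d (a :: r))).
by rewrite (big_picks_picks t (fun b c => H b a c)) -big_split.
Qed.

Lemma big_picks2_picks s (H : T -> T -> T -> seq T -> V) :
  \sum_(p <- picks2 s) \sum_(q <- picks p.2) H p.1.1 p.1.2 q.1 q.2 =
  \sum_(p <- picks3 s) (H p.1.1.2 p.1.2 p.1.1.1 p.2 +
    (H p.1.1.1 p.1.2 p.1.1.2 p.2 + H p.1.1.1 p.1.1.2 p.1.2 p.2)).
Proof.
elim: s H => [|a t IH] H /=; first by rewrite !big_nil.
rewrite !big_cat !big_map /=.
under [X in _ + X = _]eq_bigr => p _ do rewrite big_cons big_map.
rewrite big_split /= (IH (fun b c d r => H b c d (a :: r))).
rewrite (big_picks_picks t (fun b c => H a b c)) addrA -big_split /=.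
by congr (_ + _); apply: eq_bigr => p _; rewrite addrC [X in _ + X]addrC.
Qed.

Lemma big_picks2_picksC s (H : T -> T -> T -> seq T -> V) :
  \sum_(p <- picks2 s) \sum_(q <- picks p.2) H p.1.1 p.1.2 q.1 q.2 =
  \sum_(p <- picks s) \sum_(q <- picks2 p.2) H q.1.1 q.1.2 p.1 q.2.
Proof.
by rewrite big_picks2_picks (big_picks_picks2 s (fun a b c => H b c a)).
Qed.

End Picks.

Lemma picks_size {T : eqType} {s : seq T} {p} :
  p \in picks s -> (size p.2).+1 = size s.
Proof.
elim: s p => [|a t IH] p //=; rewrite in_cons => /predU1P[->//|].
by case/mapP => q /IH <- ->.
Qed.

Lemma picks2_size {T : eqType} {s : seq T} {p} :
  p \in picks2 s -> (size p.2).+2 = size s.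
Proof.
elim: s p => [|a t IH] p //=; rewrite mem_cat => /orP[] /mapP[q].
  by move=> /picks_size <- ->.
by move=> /IH <- ->.
Qed.

Lemma picks3_size {T : eqType} {s : seq T} {p} :
  p \in picks3 s -> (size p.2).+3 = size s.
Proof.
elim: s p => [|a t IH] p //=; rewrite mem_cat => /orP[] /mapP[q].
  by move=> /picks2_size <- ->.
by move=> /IH <- ->.
Qed.

(** Exchanging the two disjoint pairs matches opposite terms. In the induction, the terms with the
    head in the first pair cancel those with the head in the second. *)
Lemma big_picks2_antisym {T : eqType} {V : zmodType} (s : seq T)
    (H : T -> T -> T -> T -> seq T -> V) :
    (forall a b c d r, (size r).+4 = size s ->
       H a b c d r + H c d a b r = 0) ->
  \sum_(p <- picks2 s) \sum_(q <- picks2 p.2) H p.1.1 p.1.2 q.1.1 q.1.2 q.2 = 0.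
Proof.
elim: s H => [|a t IH] H HN /=; first by rewrite big_nil.
rewrite big_cat !big_map /=.
under [X in _ + X = _]eq_bigr => p _ do rewrite big_cat !big_map.
rewrite big_split /= (IH (fun b c d e r => H b c d e (a :: r))) => [|b c d e r sr].
  rewrite addr0 (big_picks2_picksC t (fun b c => H b c a)) -big_split big_seq big1 //= => p pt.
  rewrite -big_split big_seq big1 //= => q qp; apply: HN.
  by rewrite (picks2_size qp) (picks_size pt).
by apply: HN; rewrite /= sr.
Qed.

(** * The coboundary identity for functions of a list and a last argument *)

Section SeqCochains.
Context {K : fieldType} {A V : lmodType K}.
Variables (mul : {bilinear A -> A -> A}) (rho mu : {bilinear A -> V -> V}).
Hypothesis hA : left_pre_jacobi_jordan mul.
Hypothesis hV : representation mul rho mu.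

Definition seq_rho (E : seq A -> A -> V) s w :=
  \sum_(p <- picks s) rho p.1 (E p.2 w).

Definition seq_mu (E : seq A -> A -> V) s w :=
  \sum_(p <- picks s) mu w (E p.2 p.1).

Definition seq_mul (E : seq A -> A -> V) s w :=
  \sum_(p <- picks s) E p.2 (mul p.1 w).

Definition seq_star (E : seq A -> A -> V) s w :=
  \sum_(p <- picks2 s) E (star mul p.1.1 p.1.2 :: p.2) w.

(** The algebra identity turns [star (star a b) c] into the differences [c(ab) - a(bc)] and
    [c(ba) - b(ac)]; each of the two telescopes over the cyclic permutations. *)
Let star_jacobi x y z :
  star mul (star mul x y) z + star mul (star mul y z) x +
  star mul (star mul z x) y = 0.
Proof.
have mulE a b c : mul (star mul a b) c = - (mul a (mul b c) + mul b (mul a c)).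
  apply/eqP; rewrite -addr_eq0 /star linearDl; apply/eqP.
  by rewrite -[RHS](hA a b c) addrACA addrA.
have starE a b c : star mul (star mul a b) c =
    (mul c (mul a b) - mul a (mul b c)) + (mul c (mul b a) - mul b (mul a c)).
  by rewrite addrACA -opprD -mulE -linearDr addrC.
rewrite !starE (addrACA (_ - _) _ (_ - _)) (addrACA _ _ (_ - _)).
rewrite subrKA subrKA subrr add0r.
by rewrite (addrC (_ - _) (_ - _)) subrKA subrKA subrr.
Qed.

(** [E] models a cochain of degree [n.+1], so its properties are required only on [n] leading
    arguments. Alternation enters as skew-symmetry in the first two. *)
Variables (n : nat) (E : seq A -> A -> V).
Hypothesis E_addr_last : forall s, size s = n -> {morph E s : a b / a + b}.
Hypothesis E_addr_head : forall s w, (size s).+1 = n ->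
  {morph (fun a => E (a :: s) w) : a b / a + b}.
Hypothesis E_alternating : forall a b s w, (size s).+2 = n ->
  E (a :: b :: s) w + E (b :: a :: s) w = 0.
Hypothesis E_cyclic : forall a b c s w, (size s).+1 = n ->
  E (star mul a b :: s) (mul c w) + E (star mul b c :: s) (mul a w) +
  E (star mul c a :: s) (mul b w) = 0.

(** In [seq_star (seq_rho E)], [rho] takes either the new head [a * b], which cancels
    [rho a rho b + rho b rho a], or an older entry, which gives the right-hand side. *)
Lemma seq_rho_rho_star s w :
  seq_rho (seq_rho E) s w + seq_star (seq_rho E) s w = seq_rho (seq_star E) s w.
Proof.
have RR : seq_rho (seq_rho E) s w =
    - \sum_(p <- picks2 s) rho (star mul p.1.1 p.1.2) (E p.2 w).
  rewrite /seq_rho; under eq_bigr do rewrite raddf_sum.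
  rewrite (big_picks_picks s (fun a b r => rho a (rho b (E r w)))) -sumrN.
  apply: eq_bigr => p _; apply/eqP; rewrite -addr_eq0 addrC addrA.
  by rewrite hV.1.
have -> : seq_star (seq_rho E) s w = \sum_(p <- picks2 s)
   rho (star mul p.1.1 p.1.2) (E p.2 w) + seq_rho (seq_star E) s w.
  rewrite /seq_star /seq_rho; under eq_bigr do rewrite /= big_cons big_map /=.
  under [X in _ = _ + X]eq_bigr do rewrite raddf_sum.
  rewrite big_split; congr (_ + _).
  exact: (big_picks2_picksC s (fun a b c r => rho c (E (star mul a b :: r) w))).
by rewrite RR addKr.
Qed.

Lemma seq_rho_mu_relation s w :
  seq_rho (seq_mu E) s w + seq_mu (seq_rho E) s w + seq_mu (seq_mu E) s w +
  seq_mul (seq_mu E) s w = 0.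
Proof.
have -> : seq_mu (seq_rho E) s w =
    \sum_(p <- picks s) \sum_(q <- picks p.2) mu w (rho p.1 (E q.2 q.1)).
  (* Exchanging the two extractions makes all four summands match the second axiom at [p.1], [w] and
     the vector [E q.2 q.1]. *)
  rewrite /seq_mu /seq_rho; under eq_bigr do rewrite raddf_sum.
  exact: (big_picks_picksC s (fun a b r => mu w (rho b (E r a)))).
rewrite /seq_rho /seq_mu /seq_mul.
under [X in X + _ + _ + _]eq_bigr do rewrite raddf_sum.
under [X in _ + _ + X + _]eq_bigr do rewrite raddf_sum.
rewrite /= -!big_split big1 //= => p _; rewrite -!big_split big1 //= => q _.
rewrite -[RHS](hV.2 p.1 w (E q.2 q.1)).
by rewrite [RHS]addrC [X in _ = _ + X]addrC [X in _ = _ + (_ + X)]addrC !addrA.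
Qed.

Lemma seq_rho_mulC s w : seq_rho (seq_mul E) s w = seq_mul (seq_rho E) s w.
Proof.
rewrite /seq_rho /seq_mul; under eq_bigr do rewrite raddf_sum.
exact: (big_picks_picksC s (fun a b r => rho a (E r (mul b w)))).
Qed.

(** When [mu] moves the head [a * b] to the last place, additivity there splits it into [a . b] and
    [b . a], the two orders of extraction in [seq_mu (seq_mul E)]. *)
Lemma seq_star_mu s w : size s = n.+2 ->
  seq_star (seq_mu E) s w = seq_mu (seq_mul E) s w + seq_mu (seq_star E) s w.
Proof.
move=> ss; rewrite /seq_star /seq_mu /seq_mul.
under eq_bigr do rewrite /= big_cons big_map /=.
under [X in _ = X + _]eq_bigr do rewrite raddf_sum.
under [X in _ = _ + X]eq_bigr do rewrite raddf_sum.
rewrite big_split; congr (_ + _); last first.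
  exact: (big_picks2_picksC s (fun a b c r => mu w (E (star mul a b :: r) c))).
rewrite (big_picks_picks s (fun a b r => mu w (E r (mul b a)))).
rewrite big_seq [RHS]big_seq; apply: eq_bigr => p /picks2_size; rewrite ss => -[sp].
by rewrite -linearDr -(E_addr_last _ sp) /star addrC.
Qed.

Lemma seq_mul_mul_star s w : size s = n.+2 ->
  seq_mul (seq_mul E) s w + seq_star (seq_mul E) s w = 0.
Proof.
move=> ss; rewrite /seq_star /seq_mul.
under [X in _ + X]eq_bigr do rewrite /= big_cons big_map /=.
rewrite big_split /= addrA.
rewrite (big_picks_picks s (fun a b r => E r (mul b (mul a w)))).
rewrite (big_picks2_picks s (fun a b c r => E (star mul a b :: r) (mul c w))).
rewrite -big_split !big_seq !big1 ?addr0 //= => p.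
  move=> /picks3_size; rewrite ss => -[sp].
  by rewrite addrA -[RHS](E_cyclic p.1.1.2 p.1.2 p.1.1.1 p.2 w sp) (starC _ p.1.2).
move=> /picks2_size; rewrite ss => -[sp].
(* The three terms merge into one value at [v], which is zero by the algebra identity; additivity
   then gives [E p.2 0 = 0]. *)
rewrite -!(E_addr_last _ sp); set v := (X in E _ X).
suff -> : v = 0 by apply: (@addIr _ (E p.2 0)); rewrite -(E_addr_last _ sp) !add0r.
rewrite /v -[RHS](hA p.1.1 p.1.2 w) /star linearDl /=.
by rewrite addrC (addrC (mul _ (mul p.1.1 w))) addrACA !addrA.
Qed.

Lemma seq_mul_star s w : size s = n.+2 -> seq_mul (seq_star E) s w = 0.
Proof.
move=> ss; rewrite /seq_star /seq_mul.
rewrite (big_picks_picks2 s (fun a b c r => E (star mul b c :: r) (mul a w))).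
rewrite big_seq big1 //= => p /picks3_size; rewrite ss => -[sp].
rewrite -[RHS](E_cyclic p.1.1.2 p.1.2 p.1.1.1 p.2 w sp) -addrA.
(* The triple is listed in order, whereas the cyclic condition has its first and third entries
   starred in reverse. *)
by rewrite (starC _ p.1.2).
Qed.

Lemma seq_star_star s w : size s = n.+2 -> seq_star (seq_star E) s w = 0.
Proof.
move=> ss; rewrite /seq_star.
under eq_bigr do rewrite /= big_cat !big_map /=.
(* The second pair either avoids the head [a * b], handled by alternation, or contains it, leaving
   the terms [(a * b) * c]. *)
rewrite big_split /= (big_picks2_antisym s (fun a b c d r =>
  E (star mul c d :: star mul a b :: r) w)) ?addr0; last first.
  by move=> a b c d r sr; apply: E_alternating; move: ss; rewrite -sr => -[].
rewrite (big_picks2_picks s (fun a b c r => E (star mul (star mul a b) c :: r) w)).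
rewrite big_seq big1 //= => p /picks3_size; rewrite ss => -[sp].
have E0 : E (0 :: p.2) w = 0.
  have /= := E_addr_head _ w sp 0 0.
  by rewrite addr0 => /esym/(canRL (addrK _)) ->; rewrite subrr.
rewrite -!(E_addr_head _ _ sp) (_ : _ + _ = 0) //.
rewrite -[RHS](star_jacobi p.1.1.2 p.1.2 p.1.1.1) addrA.
by rewrite (starC mul p.1.2).
Qed.

Lemma seq_coboundary_comp s w : size s = n.+2 ->
  let G r z := seq_rho E r z + seq_mu E r z - seq_mul E r z - seq_star E r z in
  seq_rho G s w + seq_mu G s w + seq_mul G s w + seq_star G s w = 0.
Proof.
move=> ss G.
have -> : seq_rho G s w = seq_rho (seq_rho E) s w + seq_rho (seq_mu E) s w -
    seq_rho (seq_mul E) s w - seq_rho (seq_star E) s w.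
  by rewrite -big_split -!sumrB; apply: eq_bigr => p _; rewrite !linearBr linearDr.
have -> : seq_mu G s w = seq_mu (seq_rho E) s w + seq_mu (seq_mu E) s w -
    seq_mu (seq_mul E) s w - seq_mu (seq_star E) s w.
  by rewrite -big_split -!sumrB; apply: eq_bigr => p _; rewrite !linearBr linearDr.
have -> : seq_mul G s w = seq_mul (seq_rho E) s w + seq_mul (seq_mu E) s w -
    seq_mul (seq_mul E) s w - seq_mul (seq_star E) s w.
  by rewrite -big_split -!sumrB.
have -> : seq_star G s w = seq_star (seq_rho E) s w + seq_star (seq_mu E) s w -
    seq_star (seq_mul E) s w - seq_star (seq_star E) s w.
  by rewrite -big_split -!sumrB.
rewrite seq_star_star // seq_mul_star // !subr0 -seq_rho_mulC seq_star_mu //.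
have := seq_rho_mu_relation s w; have := seq_mul_mul_star s w ss.
have := seq_rho_rho_star s w.
move: (seq_rho (seq_rho E) s w) (seq_rho (seq_mu E) s w) => RR RM.
move: (seq_rho (seq_star E) s w) (seq_rho (seq_mul E) s w) => RS RP.
move: (seq_mu (seq_rho E) s w) (seq_mu (seq_mu E) s w) => MR MM.
move: (seq_mu (seq_mul E) s w) (seq_mu (seq_star E) s w) => MP MS.
move: (seq_mul (seq_mu E) s w) (seq_mul (seq_mul E) s w) => PM PP.
move: (seq_star (seq_rho E) s w) (seq_star (seq_mul E) s w) => SR SP.
(* The relations eliminate [RS], [SP] and [PM]; the remaining eighteen terms form nine opposite
   pairs. *)
move=> <- /addr0_eq <- /addr0_eq <-.
rewrite !opprD !opprK !addrA.
rewrite [LHS](ACl (1*4*(2*11)*(10*3)*(15*5)*(6*12)*(7*13)*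
                   (16*8)*(17*9)*(18*14))%AC) /=.
by rewrite !subrr !addr0.
Qed.


End SeqCochains.

(** * Argument tuples as lists *)

Section FfunOfSeq.
Context {K : fieldType} {A : lmodType K}.

(** Total on lists: missing entries are read as 0 and surplus ones ignored. *)
Definition ffun_of_seq n (s : seq A) : {ffun 'I_n -> A} :=
  [ffun k : 'I_n => nth 0 s k].

Lemma ffun_of_seqK n (x : {ffun 'I_n.+1 -> A}) :
  exists2 s, size s = n & exists w, x = ffun_of_seq n.+1 (rcons s w).
Proof.
exists [seq x (inord i) | i <- iota 0 n]; first by rewrite size_map size_iota.
exists (x ord_max); apply/ffunP => k; rewrite ffunE nth_rcons size_map size_iota.
case: ltnP => [lkn|lnk].
  by rewrite (nth_map 0) ?size_iota // nth_iota // add0n inord_val.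
have kn : k = n :> nat by apply/eqP; rewrite eqn_leq lnk leq_ord.
by rewrite kn eqxx; congr (x _); apply: val_inj.
Qed.

Lemma omit_ffun_of_seq n (i : 'I_n.+1) s : (i < size s)%N ->
  omit i (ffun_of_seq n.+1 s) = ffun_of_seq n (del i s).
Proof. by move=> lis; apply/ffunP => k; rewrite !ffunE nth_del. Qed.

Lemma omit_lift_ffun_of_seq n (i : 'I_n) s a : (i < size s)%N ->
  omit (lift ord_max i) (ffun_of_seq n.+1 (rcons s a)) =
  ffun_of_seq n (rcons (del i s) a).
Proof.
move=> lis; have lia : (lift ord_max i < size (rcons s a))%N.
  by rewrite lift_max size_rcons ltnW.
by rewrite omit_ffun_of_seq // lift_max del_rcons.
Qed.

Lemma cons_arg_ffun_of_seq n a s :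
  cons_arg a (ffun_of_seq n s) = ffun_of_seq n.+1 (a :: s).
Proof.
by apply/ffunP => k; rewrite !ffunE; case: unliftP => [k' ->|->] //=; rewrite ffunE.
Qed.

Lemma set_last_ffun_of_seq n s a b : size s = n ->
  set_last (ffun_of_seq n.+1 (rcons s a)) b = ffun_of_seq n.+1 (rcons s b).
Proof.
move=> sn; apply/ffunP => k; rewrite !ffunE !nth_rcons sn -val_eqE /=.
by case: ltngtP (leq_ord k).
Qed.

Lemma ffun_of_seq_last n s a : size s = n ->
  ffun_of_seq n.+1 (rcons s a) ord_max = a.
Proof. by move=> sn; rewrite ffunE nth_rcons sn ltnn eqxx. Qed.

Lemma ffun_of_seq_head n s a (i : 'I_n) : size s = n ->
  ffun_of_seq n.+1 (rcons s a) (lift ord_max i) = nth 0 s i.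
Proof. by move=> sn; rewrite ffunE lift_max nth_rcons sn ltn_ord. Qed.

End FfunOfSeq.

(** * Transfer of the coboundary sums and cochain properties to lists *)

Section CochainsOnSeq.
Context {K : fieldType} {A V : lmodType K}.
Variables (mul : {bilinear A -> A -> A}) (rho mu : {bilinear A -> V -> V}).

Definition seq_cochain n (f : cochain A V n.+1) s w :=
  f (ffun_of_seq n.+1 (rcons s w)).

Lemma sum_rho_seq n (f : cochain A V n.+1) s w : size s = n.+1 ->
  sum_rho rho f (ffun_of_seq n.+2 (rcons s w)) = seq_rho rho (seq_cochain n f) s w.
Proof.
move=> sn; rewrite /seq_rho -(big_picks_nth 0 s (fun a r => rho a (seq_cochain n f r w))).
rewrite sn; apply: eq_bigr => i _; have lis : (i < size s)%N by rewrite sn.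
by rewrite ffun_of_seq_head // omit_lift_ffun_of_seq.
Qed.

Lemma sum_mu_seq n (f : cochain A V n.+1) s w : size s = n.+1 ->
  sum_mu mu f (ffun_of_seq n.+2 (rcons s w)) = seq_mu mu (seq_cochain n f) s w.
Proof.
move=> sn; rewrite /seq_mu -(big_picks_nth 0 s (fun a r => mu w (seq_cochain n f r a))).
rewrite sn; apply: eq_bigr => i _; have lis : (i < size s)%N by rewrite sn.
rewrite ffun_of_seq_head // ffun_of_seq_last // omit_lift_ffun_of_seq //.
by rewrite set_last_ffun_of_seq //; move: (size_del _ _ lis); rewrite sn => -[].
Qed.

Lemma sum_mul_seq n (f : cochain A V n.+1) s w : size s = n.+1 ->
  sum_mul mul f (ffun_of_seq n.+2 (rcons s w)) = seq_mul mul (seq_cochain n f) s w.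
Proof.
move=> sn; rewrite /seq_mul -(big_picks_nth 0 s (fun a r => seq_cochain n f r (mul a w))).
rewrite sn; apply: eq_bigr => i _; have lis : (i < size s)%N by rewrite sn.
rewrite ffun_of_seq_head // ffun_of_seq_last // omit_lift_ffun_of_seq //.
by rewrite set_last_ffun_of_seq //; move: (size_del _ _ lis); rewrite sn => -[].
Qed.

Lemma sum_star_seq n (f : cochain A V n.+1) s w : size s = n.+1 ->
  sum_star mul f (ffun_of_seq n.+2 (rcons s w)) = seq_star mul (seq_cochain n f) s w.
Proof.
move=> sn; rewrite /seq_star.
rewrite -(big_picks2_nth 0 s (fun a b r => seq_cochain n f (star mul a b :: r) w)).
rewrite sn; apply: eq_bigr => i _; apply: eq_bigr => j lij.
have ljs : (j < size s)%N by rewrite sn.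
(* Since [i < j], deleting position [j] leaves position [i] in range. *)
have lis : (i < size (del j s))%N.
  by rewrite -ltnS size_del // sn (leq_trans _ (ltn_ord j)).
rewrite !ffun_of_seq_head // /omit2 omit_lift_ffun_of_seq //.
have lia : (i < size (rcons (del j s) w))%N by rewrite size_rcons ltnW.
by rewrite omit_ffun_of_seq // del_rcons // cons_arg_ffun_of_seq.
Qed.

Lemma seq_cochain_addr_last n (f : cochain A V n.+1) s : size s = n ->
  {morph seq_cochain n f s : a b / a + b}.
Proof.
move=> sn a b; set y := ffun_of_seq n.+1 (rcons s 0).
have fE c : seq_cochain n f s c = f (set_last y c).
  by rewrite /y set_last_ffun_of_seq.
(* Linearity with scalar 1 is additivity. *)
by rewrite !fE; have := cochain_multilinear f ord_max y 1 a b; rewrite !scale1r.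
Qed.

Lemma seq_cochain_addr_head n (f : cochain A V n.+1) s w :
  {morph (fun a => seq_cochain n f (a :: s) w) : a b / a + b}.
Proof.
move=> a b; rewrite /seq_cochain /= -!cons_arg_ffun_of_seq.
by have := cochain_cons_linear f (ffun_of_seq n (rcons s w)) 1 a b; rewrite !scale1r.
Qed.

Lemma seq_cochain_addr_second n (f : cochain A V n.+2) a s w :
  {morph (fun b => seq_cochain n.+1 f (a :: b :: s) w) : b c / b + c}.
Proof.
move=> b c; rewrite /seq_cochain /= -!cons_arg_ffun_of_seq.
set y := ffun_of_seq n (rcons s w).
have fE e : cons_arg a (cons_arg e y) =
    upd (cons_arg a (cons_arg 0 y)) (lift ord0 ord0) e.
  by rewrite -cons_arg_upd -cons_arg_upd0.
rewrite (fE b) (fE c) (fE (b + c)); have := cochain_multilinear f (lift ord0 ord0)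
  (cons_arg a (cons_arg 0 y)) 1 b c.
by rewrite !scale1r.
Qed.

(** Polarisation: expanding the vanishing value at [a + b, a + b] leaves the two mixed terms. *)
Lemma seq_cochain_alternating n (f : acochain V mul n) a b s w :
  (size s).+2 = n ->
  seq_cochain n f (a :: b :: s) w + seq_cochain n f (b :: a :: s) w = 0.
Proof.
case: n f => [|[|n]] // f _.
have f0 c : seq_cochain n.+2 f (c :: c :: s) w = 0.
  by apply: (@acochain_alternating _ _ _ _ _ f _ ord0 (lift ord0 ord0)); rewrite ?ffunE.
rewrite -[RHS](f0 (a + b)) seq_cochain_addr_head !seq_cochain_addr_second.
by rewrite !f0 add0r addr0.
Qed.

Lemma seq_cochain_cyclic n (f : acochain V mul n) a b c s w :
  (size s).+1 = n ->
  seq_cochain n f (star mul a b :: s) (mul c w) +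
  seq_cochain n f (star mul b c :: s) (mul a w) +
  seq_cochain n f (star mul c a :: s) (mul b w) = 0.
Proof.
case: n f => [|n] // f [sn].
have := @acochain_cyclic _ _ _ _ _ f a b c (ffun_of_seq n.+1 (rcons s w)).
by rewrite ffun_of_seq_last // !set_last_ffun_of_seq // !cons_arg_ffun_of_seq.
Qed.

End CochainsOnSeq.

(* In the indexing of [d] and [delta] this is d^{n+2} o delta^{n+1} = 0 for all
   n >= 0. *)
Theorem proposition3p1 (K : fieldType) (A V : lmodType K)
    (mul : {bilinear A -> A -> A}) (rho mu : {bilinear A -> V -> V})
    (hA : left_pre_jacobi_jordan mul) (hV : representation mul rho mu)
    (n : nat) (f : acochain V mul n) (x : {ffun 'I_n.+3 -> A}) :
  d mul rho mu (delta rho mu f) x = 0.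
Proof.
have [s sn [w ->]] := ffun_of_seqK n.+2 x.
rewrite /= sum_rho_seq // sum_mu_seq // sum_mul_seq // sum_star_seq //.
rewrite -[RHS](seq_coboundary_comp mul rho mu hA hV n (seq_cochain n f)
  (seq_cochain_addr_last n f) (fun s w _ => seq_cochain_addr_head n f s w)
  (seq_cochain_alternating mul n f) (seq_cochain_cyclic mul n f) s w sn).
have deltaE r z : size r = n.+1 ->
    seq_cochain n.+1 (delta rho mu f) r z =
    seq_rho rho (seq_cochain n f) r z + seq_mu mu (seq_cochain n f) r z -
    seq_mul mul (seq_cochain n f) r z - seq_star mul (seq_cochain n f) r z.
  move=> rn; rewrite /seq_cochain /=.
  by rewrite sum_rho_seq // sum_mu_seq // sum_mul_seq // sum_star_seq.
(* [deltaE] needs lists of length [n.+1]; membership in [picks] or [picks2] supplies this, two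
   extracted entries being replaced by one product in the star sum. *)
congr (_ + _ + _ + _).
- rewrite /seq_rho big_seq [RHS]big_seq; apply: eq_bigr => p /picks_size.
  by rewrite sn => -[/deltaE ->].
- rewrite /seq_mu big_seq [RHS]big_seq; apply: eq_bigr => p /picks_size.
  by rewrite sn => -[/deltaE ->].
- rewrite /seq_mul big_seq [RHS]big_seq; apply: eq_bigr => p /picks_size.
  by rewrite sn => -[/deltaE ->].
- rewrite /seq_star big_seq [RHS]big_seq; apply: eq_bigr => p /picks2_size.
  by rewrite sn => -[sp]; apply: deltaE; rewrite /= sp.
Qed.
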